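(* Let $(\mathcal{T},\mathcal{G})$ be a tree of finite groups with completion $\mathcal{G}_\mathcal{T}$, and let $(\mathcal{T},\mathcal{F},\mathcal{S})$ be a tree of fusion systems induced by $(\mathcal{T},\mathcal{G})$ which satisfies Hypothesis $(H)$ with distinguished vertex $v_*$, so that it has completion $\mathcal{F}_\mathcal{T}$ on $\mathcal{S}(v_* )$. Then: (a) $\mathcal{S}(v_* )$ (viewed as a subgroup of $\mathcal{G}(v_* )\le\mathcal{G}_\mathcal{T}$) is a Sylow $p$-subgroup of $\mathcal{G}_\mathcal{T}$, i.e. every finite $p$-subgroup of $\mathcal{G}_\mathcal{T}$ is $\mathcal{G}_\mathcal{T}$-conjugate to a subgroup of $\mathcal{S}(v_* )$. (b) $\mathcal{F}_{\mathcal{S}(v_* )}(\mathcal{G}_\mathcal{T})=\mathcal{F}_\mathcal{T}$. In particular $\mathcal{F}_\mathcal{T}$ does not depend on the choice of the tree of fusion systems induced by $(\mathcal{T},\mathcal{G})$.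
   Context: Conventions: maps act on the right; $x^g=g^{-1}xg$; $c_g$ is conjugation by $g$. A finite tree $\mathcal{T}$ is viewed as a category with objects its vertices and edges and a morphism $f_{ev}:e\to v$ for each vertex $v$ incident on edge $e$. A tree of groups $(\mathcal{T},\mathcal{G})$ is a functor $\mathcal{G}$ from $\mathcal{T}$ to groups sending each $f_{ev}$ to a monomorphism; its completion $\mathcal{G}_\mathcal{T}$ is the colimit (iterated amalgamated free product), into which all $\mathcal{G}(v),\mathcal{G}(e)$ embed. For a group $G$ with finite $p$-subgroup $S$ that is Sylow (every finite $p$-subgroup of $G$ is conjugate into $S$), $\mathcal{F}_S(G)$ is the fusion system on $S$ with $\operatorname{Hom}(P,Q)$ the conjugation maps $c_g:P\to Q$, $g\in G$, $P^g\le Q$. A tree of fusion systems induced by $(\mathcal{T},\mathcal{G})$: choose $\mathcal{S}(v)\in\operatorname{Syl}_p(\mathcal{G}(v))$, $\mathcal{S}(e)\in\operatorname{Syl}_p(\mathcal{G}(e))$ and for $v$ incident on $e$ an element $g_{ev}\in\mathcal{G}(v)$ with $(\mathcal{S}(e)\mathcal{G}(f_{ev}))^{g_{ev}}\le\mathcal{S}(v)$; put $\mathcal{S}(f_{ev}):=\mathcal{G}(f_{ev})\circ c_{g_{ev}}|_{\mathcal{S}(e)}$, $\mathcal{F}(v)=\mathcal{F}_{\mathcal{S}(v)}(\mathcal{G}(v))$, $\mathcal{F}(e)=\mathcal{F}_{\mathcal{S}(e)}(\mathcal{G}(e))$. Hypothesis $(H)$: there is a vertex $v_*$ such that for each vertex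 $v\ne v_*$, with $e$ the edge at $v$ on the minimal path from $v$ to $v_*$, $\mathcal{S}(f_{ev})$ is an isomorphism $\mathcal{S}(e)\to\mathcal{S}(v)$. Under $(H)$, all $\mathcal{S}(v),\mathcal{S}(e)$ are identified with subgroups of $S=\mathcal{S}(v_* )$ via these isomorphisms and the maps $\mathcal{S}(f_{ev})$ (which become inclusions), and the completion is $\mathcal{F}_\mathcal{T}=\langle\operatorname{Hom}_{\mathcal{F}(v)}(P,\mathcal{S}(v))\mid P\le\mathcal{S}(v),v\in V(\mathcal{T})\rangle_S$, the smallest fusion system on $S$ containing every $\mathcal{F}(v)$. *)

(* Defs.v *)
From HB Require Import structures.
From mathcomp Require Import all_boot all_order all_fingroup all_solvable.
Set Implicit Arguments. Unset Strict Implicit. Unset Printing Implicit Defensive.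
Local Open Scope group_scope.

(* Finite rooted trees.  A finite tree T with a distinguished vertex r      *)
(* (= v_* ) is encoded by its vertex set V (a finType) and the "parent"    *)
(* map par : V -> V sending v <> r to the next vertex on the minimal path  *)
(* from v to r.  The edges of T are exactly the pairs {v, par v}, v <> r;   *)
(* the edge attached to v <> r is the edge at v on the minimal path v->r.  *)
Definition rooted_tree (V : finType) (r : V) (par : V -> V) : Prop :=
  par r = r /\ forall v : V, exists n : nat, iter n par v = r.

(* Tree of finite groups: vertex group G v <= gT v, edge group Ge v <= eT v *)
(* for the edge e_v = {v, par v} (v <> r), monomorphisms                    *)
(*   fd v = G(f_{e_v v})       : Ge v -> G v                               *)
(*   fu v = G(f_{e_v (par v)}) : Ge v -> G (par v).                        *)
(* (data attached to the root r is junk and ignored).                      *)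
Definition tree_of_groups (V : finType) (r : V) (par : V -> V)
  (gT eT : V -> finGroupType)
  (G : forall v, {group gT v}) (Ge : forall v, {group eT v})
  (fd : forall v, {morphism Ge v >-> gT v})
  (fu : forall v, {morphism Ge v >-> gT (par v)}) : Prop :=
  rooted_tree r par /\
  forall v, v != r ->
    [/\ 'injm (fd v), 'injm (fu v),
        fd v @* Ge v \subset G v & fu v @* Ge v \subset G (par v)].

Definition hom_on (gT : finGroupType) (C : groupType) (A : {set gT})
  (f : gT -> C) : Prop :=
  forall x y, x \in A -> y \in A -> f (x * y) = f x * f y.

Definition group_hom (C H : groupType) (f : C -> H) : Prop :=
  forall x y, f (x * y) = f x * f y.

Definition cocone (V : finType) (r : V) (par : V -> V)
  (gT eT : V -> finGroupType)
  (G : forall v, {group gT v}) (Ge : forall v, {group eT v})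
  (fd : forall v, {morphism Ge v >-> gT v})
  (fu : forall v, {morphism Ge v >-> gT (par v)})
  (H : groupType) (j : forall v, gT v -> H) : Prop :=
  (forall v, hom_on (G v) (j v)) /\
  (forall v, v != r -> forall x, x \in Ge v -> j v (fd v x) = j (par v) (fu v x)).

(* (C, iv) is the completion G_T = colimit of the tree of groups, defined  *)
(* by its universal property (among all groups with a choice structure).   *)
Definition is_completion (V : finType) (r : V) (par : V -> V)
  (gT eT : V -> finGroupType)
  (G : forall v, {group gT v}) (Ge : forall v, {group eT v})
  (fd : forall v, {morphism Ge v >-> gT v})
  (fu : forall v, {morphism Ge v >-> gT (par v)})
  (C : groupType) (iv : forall v, gT v -> C) : Prop :=
  @cocone V r par gT eT G Ge fd fu C iv /\
  forall (H : groupType) (j : forall v, gT v -> H), @cocone V r par gT eT G Ge fd fu H j ->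
    exists phi : C -> H,
      [/\ group_hom phi,
          (forall v x, x \in G v -> phi (iv v x) = j v x) &
          forall psi : C -> H, group_hom psi ->
            (forall v x, x \in G v -> psi (iv v x) = j v x) ->
            forall c, psi c = phi c].

Definition is_subgroup (C : groupType) (P : C -> Prop) : Prop :=
  [/\ P 1, (forall x y, P x -> P y -> P (x * y)) & (forall x, P x -> P x^-1)].

Definition finite_p_subgroup (p : nat) (C : groupType) (P : C -> Prop) : Prop :=
  is_subgroup P /\
  exists s : seq C, [/\ uniq s, (forall x, P x <-> x \in s) &
                        exists k : nat, size s = (p ^ k)%N].

(* Fusion systems on a finite p-group S.  A fusion system is given by the  *)
(* predicate F P Q phi : "phi (restricted to P) belongs to Hom_F(P,Q)";    *)
(* morphisms are maps on P, so F only depends on phi restricted to P.      *)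
(* Maps act on the right: the composite "phi then psi" is x |-> psi (phi x).*)
Definition fusion_pred (gT : finGroupType) :=
  {group gT} -> {group gT} -> (gT -> gT) -> Prop.

Definition is_fusion_system (gT : finGroupType) (S : {group gT})
  (F : fusion_pred gT) : Prop :=
  [/\
      (forall (P Q : {group gT}) (phi psi : gT -> gT), {in P, phi =1 psi} -> F P Q phi -> F P Q psi),
      (forall (P Q : {group gT}) (phi : gT -> gT), F P Q phi ->
         [/\ P \subset S, Q \subset S,
             {in P &, {morph phi : x y / x * y}},
             {in P &, injective phi} & {in P, forall x, phi x \in Q}]),
      (forall (P Q : {group gT}) g, P \subset S -> Q \subset S -> g \in S ->
         P :^ g \subset Q -> F P Q (fun x => x ^ g)),
      (forall (P Q R : {group gT}) (phi psi : gT -> gT), F P Q phi -> F Q R psi ->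
         F P R (fun x => psi (phi x))) &
      (* every morphism is an F-isomorphism followed by an inclusion *)
      (forall (P Q R : {group gT}) (phi : gT -> gT), F P Q phi -> R :=: phi @: P ->
         F P R phi /\ exists psi, F R P psi /\ {in P, forall x, psi (phi x) = x})].

(* The tree of fusion systems induced by the tree of groups:               *)
(*  Sv v in Syl_p(G v), Se v in Syl_p(Ge v), elements gd v in G v,         *)
(*  gu v in G (par v) with (Se v fd v)^(gd v) <= Sv v and                   *)
(*  (Se v fu v)^(gu v) <= Sv (par v); so S(f_{e v}) x = (fd v x)^(gd v),   *)
(*  S(f_{e (par v)}) x = (fu v x)^(gu v).  Hypothesis (H) with v_* = r:    *)
(*  S(f_{e v}) maps Se v onto Sv v for v <> r.                              *)
Definition induced_tree_of_fusion_systems (p : nat) (V : finType) (r : V)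
  (par : V -> V) (gT eT : V -> finGroupType)
  (G : forall v, {group gT v}) (Ge : forall v, {group eT v})
  (fd : forall v, {morphism Ge v >-> gT v})
  (fu : forall v, {morphism Ge v >-> gT (par v)})
  (Sv : forall v, {group gT v}) (Se : forall v, {group eT v})
  (gd : forall v, gT v) (gu : forall v, gT (par v)) : Prop :=
  (forall v, Sv v \in 'Syl_p(G v)) /\
  forall v, v != r ->
    [/\ Se v \in 'Syl_p(Ge v), gd v \in G v, gu v \in G (par v),
        (fd v @* Se v) :^ gd v \subset Sv v &
        (fu v @* Se v) :^ gu v \subset Sv (par v)].

Definition hypothesis_H (V : finType) (r : V) (par : V -> V)
  (gT eT : V -> finGroupType) (Ge : forall v, {group eT v})
  (fd : forall v, {morphism Ge v >-> gT v})
  (Sv : forall v, {group gT v}) (Se : forall v, {group eT v})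
  (gd : forall v, gT v) : Prop :=
  forall v, v != r -> (fd v @* Se v) :^ gd v = Sv v.

(* The identification of each Sv v with a subgroup of S = Sv r: iota v is  *)
(* the (unique, under (H)) family with iota r = id on S and, for v <> r,   *)
(* iota v (S(f_{e v}) x) = iota (par v) (S(f_{e (par v)}) x), x in Se v,   *)
(* i.e. the maps S(f_{e w}) become inclusions.                             *)
Definition identification (V : finType) (r : V) (par : V -> V)
  (gT eT : V -> finGroupType) (Ge : forall v, {group eT v})
  (fd : forall v, {morphism Ge v >-> gT v})
  (fu : forall v, {morphism Ge v >-> gT (par v)})
  (Sv : forall v, {group gT v}) (Se : forall v, {group eT v})
  (gd : forall v, gT v) (gu : forall v, gT (par v))
  (iota : forall v, gT v -> gT r) : Prop :=
  (forall x, x \in Sv r -> iota r x = x) /\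
  (forall v, v != r -> forall x, x \in Se v ->
     iota v (fd v x ^ gd v) = iota (par v) (fu v x ^ gu v)).

(* The completion F_T: the smallest fusion system on S = Sv r containing   *)
(* every F(v) = F_{Sv v}(G v) (transported into S via iota v), i.e.        *)
(* generated by all Hom_{F(v)}(P, Sv v), P <= Sv v.                        *)
Definition contains_vertex_fusion (V : finType) (r : V)
  (gT : V -> finGroupType) (G : forall v, {group gT v})
  (Sv : forall v, {group gT v}) (iota : forall v, gT v -> gT r)
  (F : fusion_pred (gT r)) : Prop :=
  forall v (P P' T' : {group gT r}) (g : gT v) (phi : gT r -> gT r)
         (P0 : {group gT v}),
    P0 \subset Sv v -> g \in G v -> P0 :^ g \subset Sv v ->
    P' :=: iota v @: P0 -> T' :=: iota v @: Sv v ->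
    (forall x, x \in P0 -> phi (iota v x) = iota v (x ^ g)) ->
    F P' T' phi.

Definition tree_fusion_completion (V : finType) (r : V)
  (gT : V -> finGroupType) (G : forall v, {group gT v})
  (Sv : forall v, {group gT v}) (iota : forall v, gT v -> gT r)
  : fusion_pred (gT r) :=
  fun P Q phi =>
    forall F : fusion_pred (gT r), is_fusion_system (Sv r) F ->
      @contains_vertex_fusion V r gT G Sv iota F -> F P Q phi.

Definition completion_fusion (V : finType) (r : V) (gT : V -> finGroupType)
  (Sv : forall v, {group gT v}) (C : groupType) (iv : forall v, gT v -> C)
  : fusion_pred (gT r) :=
  fun P Q phi =>
    [/\ P \subset Sv r, Q \subset Sv r &
        exists g : C, forall x, x \in P ->
          phi x \in Q /\ iv r (phi x) = iv r x ^ g].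

(* Main.v *)
Require Import Defs.
From HB Require Import structures.
From mathcomp Require Import all_boot all_order all_fingroup all_solvable.
From mathcomp Require Import boolp.
Set Implicit Arguments. Unset Strict Implicit. Unset Printing Implicit Defensive.
Local Open Scope group_scope.

(* Let C act on its Bass-Serre tree, whose vertices and edges are the right
   cosets of the vertex and edge groups; it is connected because C is generated
   by the vertex groups.  Its acyclicity is extracted from the universal property
   applied to the semidirect product of C with F_2-valued functions on the edges:
   there is a cocycle recording, for each vertex, the edges on the path from the
   base vertex to it.

   (a) A finite p-subgroup P stabilises a finite subtree, which has one more vertex
   than edges.  If P fixed no vertex, it would fix no edge either, and p would
   divide both numbers.  So P is conjugate into a vertex group, hence into some
   S(v), and S(v) is conjugate into S by (H).

   (b) If g conjugates P <= S into S, then P fixes the base vertex and its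
   translate by g^-1, hence the path between them.  Along each edge of this path the
   conjugation of P into the next vertex group changes by a morphism of some F(v),
   by Sylow's theorem in the edge group.  Both inclusions use that the vertex groups
   embed into C, which follows by making them act freely on one finite set in a way
   compatible with the edges. *)

(** * Rooted trees: induction and recursion from the root *)

Section RootedTree.
Variables (V : finType) (r : V) (par : V -> V).
Hypothesis tree : rooted_tree r par.

Lemma rooted_tree_ind (P : V -> Prop) :
  P r -> (forall v, v != r -> P (par v) -> P v) -> forall v, P v.
Proof.
move=> Pr Pstep v; have [n] := tree.2 v; elim: n v => [|n IHn] v.
  by move=> /= ->.
rewrite iterSr => /IHn Pv.
by have [->//|vr] := eqVneq v r; apply: Pstep.
Qed.

Lemma par_neq v : v != r -> par v != v.
Proof.
move=> vr; apply/eqP => pv; have [n] := tree.2 v.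
have -> : iter n par v = v by elim: n => //= n ->.
by move/eqP; apply/negP.
Qed.

(** The recursion runs on fuel. Any fuel that suffices to reach [r] gives the same value, so a
    chosen bound [d v] for each vertex yields a function satisfying the equation. *)
Lemma rooted_tree_rec (A : Type) (a0 : A) (f : V -> A -> A) :
  exists t : V -> A, t r = a0 /\ forall v, v != r -> t v = f v (t (par v)).
Proof.
pose build := fix build n v := if n is n'.+1 then
  if v == r then a0 else f v (build n' (par v)) else a0.
have build_root n : build n r = a0 by case: n => //= n; rewrite eqxx.
have stable n m v : iter n par v = r -> iter m par v = r -> build n v = build m v.
  elim: n m v => [|n IHn] m v; first by move=> /= -> _; rewrite build_root.
  case: m => [|m]; first by move=> _ /= ->; rewrite eqxx.
  by rewrite !iterSr => Hn Hm /=; case: eqP => // _; rewrite (IHn m).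
have [d dP] := choice tree.2.
exists (fun v => build (d v) v); split=> [|v vr]; first by rewrite build_root.
rewrite (stable _ (d (par v)).+1 _ (dP v)) /= ?(negPf vr) //.
by rewrite -iterS iterSr dP.
Qed.

End RootedTree.

(** * An affine group over F_2 *)

Section AffineGroup.
Variables (I : Type) (C : groupType).

(** A right action of [C]: the indicator of a set D becomes the indicator of D g. *)
Definition shift (m : I -> C -> bool) (g : C) : I -> C -> bool :=
  fun i h => m i (h * g^-1).

Definition labadd (m n : I -> C -> bool) : I -> C -> bool :=
  fun i h => m i h (+) n i h.

(* The semidirect product of C with the F_2-module I -> C -> bool. *)
Definition affine : Type := (C * (I -> C -> bool))%type.

HB.instance Definition _ := Choice.on affine.

Definition affine_mul (a b : affine) : affine :=
  (a.1 * b.1, labadd (shift a.2 b.1) b.2).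
Definition affine_one : affine := (1, fun _ _ => false).
Definition affine_inv (a : affine) : affine := (a.1^-1, shift a.2 a.1^-1).

Lemma affineP (a b : affine) :
  a.1 = b.1 -> (forall i h, a.2 i h = b.2 i h) -> a = b.
Proof.
case: a b => [g m] [h n] /= -> mn; congr (_, _).
by apply/funext => i; apply/funext => k; apply: mn.
Qed.

Lemma affine_mulA : associative affine_mul.
Proof.
move=> a b c; apply: affineP => [|i h] /=; first by rewrite mulgA.
by rewrite /labadd /shift invgM !mulgA addbA.
Qed.

Lemma affine_mul1 : left_id affine_one affine_mul.
Proof. by move=> a; apply: affineP => [|i h] /=; rewrite ?mul1g. Qed.

Lemma affine_mulr1 : right_id affine_one affine_mul.
Proof.
move=> a; apply: affineP => [|i h] /=; rewrite ?mulg1 //.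
by rewrite /labadd /shift invg1 mulg1 addbF.
Qed.

Lemma affine_mulV : left_inverse affine_one affine_inv affine_mul.
Proof.
move=> a; apply: affineP => [|i h] /=; first by rewrite mulVg.
by rewrite /labadd /shift invgK mulgVK addbb.
Qed.

Lemma affine_mulrV : right_inverse affine_one affine_inv affine_mul.
Proof.
move=> a; apply: affineP => [|i h] /=; first by rewrite mulgV.
by rewrite /labadd /shift addbb.
Qed.

HB.instance Definition _ :=
  isGroup.Build affine affine_mulA affine_mul1 affine_mulr1 affine_mulV affine_mulrV.

End AffineGroup.

(** * Finite subgroups and fixed points of p-groups *)

Section FiniteSubgroup.
Variables (C : groupType) (s : seq C).
Hypothesis gs : is_subgroup (fun x => x \in s).

(** The [let] makes the type depend on [gs], so that the group structure built from this proof can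
    be attached to it. *)
Definition finsub : Type := let _ := gs in seq_sub s.
HB.instance Definition _ := Finite.copy finsub (seq_sub s).

Definition finsub_one : finsub := let: And3 g1 _ _ := gs in SeqSub g1.
Definition finsub_mul (x y : finsub) : finsub :=
  let: And3 _ gM _ := gs in SeqSub (gM _ _ (ssvalP x) (ssvalP y)).
Definition finsub_inv (x : finsub) : finsub :=
  let: And3 _ _ gV := gs in SeqSub (gV _ (ssvalP x)).

Lemma val_finsub_one : ssval finsub_one = 1.
Proof. by rewrite /finsub_one; case: gs. Qed.
Lemma val_finsub_mul x y : ssval (finsub_mul x y) = ssval x * ssval y.
Proof. by rewrite /finsub_mul; case: gs. Qed.
Lemma val_finsub_inv x : ssval (finsub_inv x) = (ssval x)^-1.
Proof. by rewrite /finsub_inv; case: gs. Qed.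

Lemma finsub_mulA : associative finsub_mul.
Proof. by move=> x y z; apply: val_inj; rewrite /= !val_finsub_mul mulgA. Qed.
Lemma finsub_mul1 : left_id finsub_one finsub_mul.
Proof.
by move=> x; apply: val_inj; rewrite /= val_finsub_mul val_finsub_one mul1g.
Qed.
Lemma finsub_mulV : left_inverse finsub_one finsub_inv finsub_mul.
Proof.
move=> x; apply: val_inj.
by rewrite /= val_finsub_mul val_finsub_inv val_finsub_one mulVg.
Qed.

HB.instance Definition _ :=
  Finite_isGroup.Build finsub finsub_mulA finsub_mul1 finsub_mulV.

End FiniteSubgroup.

(** The size of [X] is congruent mod p to the number of fixed points of the p-group. The laws of an
    action are asked on [X] only, since [vact] and [eact] satisfy the unit law only on chosen
    representatives. *)
Lemma pgroup_dvd_size (p : nat) (C : groupType) (P : C -> Prop) (T : choiceType)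
    (a : T -> C -> T) (X : seq T) :
  prime p -> finite_p_subgroup p P -> uniq X ->
  (forall u x, u \in X -> P x -> a u x \in X) ->
  (forall u, u \in X -> a u 1 = u) ->
  (forall u x y, u \in X -> a (a u x) y = a u (x * y)) ->
  (forall u, u \in X -> exists2 x, P x & a u x <> u) ->
  p %| size X.
Proof.
move=> p_pr [gP [s [us Ps [k szs]]]] uX aX a1 aM nofix.
have gs : is_subgroup (fun x => x \in s).
  case: gP => g1 gM gV; split=> [|x y|x]; rewrite -!Ps //; first exact: gM.
  exact: gV.
pose to (u : seq_sub X) (x : finsub gs) : seq_sub X :=
  SeqSub (aX _ _ (ssvalP u) ((Ps _).2 (ssvalP x))).
have to1 : to^~ 1 =1 id.
  by move=> u; apply: val_inj; rewrite /= val_finsub_one a1 ?(ssvalP u).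
have toM u : act_morph to u.
  by move=> x y; apply: val_inj; rewrite /= val_finsub_mul aM ?(ssvalP u).
pose A := TotalAction to1 toM.
have pG : p.-group [set: finsub gs].
  rewrite /pgroup cardsT card_seq_sub // szs; by rewrite pnatX pnat_id.
have acts : [acts [set: finsub gs], on [set: seq_sub X] | A].
  by apply/actsP => x _ u; rewrite !inE.
have := pgroup_fix_mod pG acts; rewrite cardsT card_seq_sub // => H.
suff F0 : 'Fix_([set: seq_sub X] | A)([set: finsub gs]) = set0.
  by move: H; rewrite F0 cards0 mod0n /dvdn => /eqP.
apply/setP => u; rewrite !inE; apply/negP => /andP[_ /subsetP fu].
have [x Px] := nofix _ (ssvalP u).
by have /[!inE] /eqP/(congr1 val) /= := fu (SeqSub ((Ps x).1 Px)) (in_setT _).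
Qed.

(** * Canonical representatives of right cosets *)

Section CosetRepresentatives.
Variables (C : groupType) (U : pred C).
Hypothesis gU : is_subgroup (fun x => U x).

Definition rep (g : C) : C := choose (fun h => U (h * g^-1)) g.

Lemma repP g : U (rep g * g^-1).
Proof.
by apply: (chooseP (P := fun h => U (h * g^-1))); rewrite mulgV; case: gU.
Qed.

(** The value of [choose] depends only on the extension of the predicate once the default satisfies
    it, so all elements of a coset get the same representative. *)
Lemma rep_eq g h : (rep g == rep h) = U (g * h^-1).
Proof.
have [_ gM gV] := gU.
apply/eqP/idP => [gh | Ugh].
  by move: (gM _ _ (gV _ (repP g)) (repP h)); rewrite invgM invgK gh -mulgA mulKg.
rewrite /rep (eq_choose (Q := fun k => U (k * h^-1))) => [|k].
  by apply: choose_id; rewrite // mulgV; case: gU.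
apply/idP/idP => Uk; first by move: (gM _ _ Uk Ugh); rewrite -mulgA mulKg.
by move: (gM _ _ Uk (gV _ Ugh)); rewrite invgM invgK -mulgA mulKg.
Qed.

Lemma rep_mul g k : rep (rep g * k) = rep (g * k).
Proof. by apply/eqP; rewrite rep_eq invgM mulgA mulgK repP. Qed.

Lemma rep_id g : rep (rep g) = rep g.
Proof. by rewrite -{1}[rep g]mulg1 rep_mul mulg1. Qed.

End CosetRepresentatives.

(** * The Bass-Serre tree *)

Section BassSerreTree.
Variables (C : groupType) (V : finType) (r : V) (par : V -> V).
Variables (K L : V -> pred C).
Hypothesis tree : rooted_tree r par.
Hypothesis gK : forall v, is_subgroup (fun x => K v x).
Hypothesis gL : forall v, is_subgroup (fun x => L v x).
Hypothesis sLK : forall v x, v != r -> L v x -> K v x.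
Hypothesis sLKp : forall v x, v != r -> L v x -> K (par v) x.
Hypothesis generated : forall D : C -> Prop, is_subgroup D ->
  (forall v x, K v x -> D x) -> forall g, D g.
(** Read [c v g w h] as: the path from the base vertex to the coset of [g] crosses the edge of [h]
    above [w]. Translation also moves the base vertex, so only differences of values are
    equivariant. *)
Variable c : V -> C -> V -> C -> bool.
Hypothesis c_coset : forall v x g, K v x -> c v (x * g) = c v g.
Hypothesis c_edge : forall v g w h, v != r ->
  c v g w h (+) c (par v) g w h = (w == v) && L v (h * g^-1).
Hypothesis c_shift : forall v g v' g' k w h,
  c v (g * k) w (h * k) (+) c v' (g' * k) w (h * k) = c v g w h (+) c v' g' w h.

Implicit Types (u w e : V * C) (v : V) (g h k : C).

(* A coset is encoded by its chosen representative: K v g by vtx v g, and the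
   edge from K v g to K (par v) g, which is L v g, by edg v g. *)
Definition vtx v g : V * C := (v, rep (K v) g).
Definition edg v g : V * C := (v, rep (L v) g).
Definition vact u g := vtx u.1 (u.2 * g).
Definition eact e g := edg e.1 (e.2 * g).
Definition is_vtx u := vtx u.1 u.2 == u.
Definition is_edg e := (e.1 != r) && (edg e.1 e.2 == e).
Definition ends v h u w :=
  (u = vtx v h /\ w = vtx (par v) h) \/ (u = vtx (par v) h /\ w = vtx v h).
Definition adj u w : bool := `[< exists v h, v != r /\ ends v h u w >].
(* The edge e separates u and w. *)
Definition sep e u w := c u.1 u.2 e.1 e.2 (+) c w.1 w.2 e.1 e.2.

Lemma vtx_eq v g h : (vtx v g == vtx v h) = K v (g * h^-1).
Proof. by rewrite xpair_eqE eqxx rep_eq. Qed.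

Lemma edg_eq v g (w : V) h : (edg v g == edg w h) = (v == w) && L v (g * h^-1).
Proof. by rewrite xpair_eqE; case: eqVneq => //= <-; rewrite rep_eq. Qed.

Lemma vact_vtx v g k : vact (vtx v g) k = vtx v (g * k).
Proof. by rewrite /vact /vtx /= rep_mul. Qed.

Lemma is_vtx_vtx v g : is_vtx (vtx v g).
Proof. by rewrite /is_vtx /vtx /= rep_id. Qed.

Lemma is_edg_edg v g : v != r -> is_edg (edg v g).
Proof. by move=> vr; rewrite /is_edg vr /edg /= rep_id. Qed.

Lemma vact1 u : is_vtx u -> vact u 1 = u.
Proof. by move=> /eqP uV; rewrite /vact mulg1. Qed.

Lemma vactM u g h : vact (vact u g) h = vact u (g * h).
Proof. by rewrite vact_vtx /vact mulgA. Qed.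

Lemma eact1 e : is_edg e -> eact e 1 = e.
Proof. by case/andP=> _ /eqP eE; rewrite /eact mulg1. Qed.

Lemma eactM e g h : eact (eact e g) h = eact e (g * h).
Proof. by rewrite /eact /edg /= rep_mul // mulgA. Qed.

Lemma vtx_edg v h : v != r -> vtx v (edg v h).2 = vtx v h.
Proof. by move=> vr; apply/eqP; rewrite vtx_eq; apply/sLK/repP. Qed.

Lemma vtxp_edg v h : v != r -> vtx (par v) (edg v h).2 = vtx (par v) h.
Proof. by move=> vr; apply/eqP; rewrite vtx_eq; apply/sLKp/repP. Qed.

Lemma ends_vtx v h u w : ends v h u w -> is_vtx u /\ is_vtx w.
Proof. by case=> -[-> ->]; rewrite !is_vtx_vtx. Qed.

Lemma ends_act v h u w k : ends v h u w -> ends v (h * k) (vact u k) (vact w k).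
Proof. by case=> -[-> ->]; rewrite !vact_vtx; [left | right]. Qed.

Lemma ends_sym v h u w : ends v h u w -> ends v h w u.
Proof. by case=> -[-> ->]; [right | left]. Qed.

(** The ends of an edge have the distinct types [v] and [par v], so the first end decides the
    orientation; in particular no edge is inverted. *)
Lemma ends_fun v h u w w' : v != r -> ends v h u w -> ends v h u w' -> w = w'.
Proof.
move=> vr; have pv := par_neq tree vr.
by case=> -[-> ->] [[E ->]|[E ->]] //; case: E pv => ->; rewrite eqxx.
Qed.

Lemma adj_sym : symmetric adj.
Proof.
move=> u w; apply/asboolP/asboolP => -[v [h [vr E]]];
by exists v, h; split=> //; apply: ends_sym.
Qed.

Lemma adj_act k u w : adj u w -> adj (vact u k) (vact w k).
Proof.
move=> /asboolP[v [h [vr E]]]; apply/asboolP; exists v, (h * k).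
by split=> //; apply: ends_act.
Qed.

Lemma c_vtx v g : c v (rep (K v) g) = c v g.
Proof. by rewrite -[rep _ _](mulgKV g) c_coset //; apply: repP. Qed.

Lemma sep_ends v h u w e :
  v != r -> ends v h u w -> sep e u w = (edg e.1 e.2 == edg v h).
Proof.
move=> vr E; have -> : sep e u w = c v h e.1 e.2 (+) c (par v) h e.1 e.2.
  by case: E => -[-> ->]; rewrite /sep /= !c_vtx // addbC.
by rewrite c_edge // edg_eq; case: eqVneq => // ->.
Qed.

Lemma sep_act e u w k :
  sep (e.1, e.2 * k) (vact u k) (vact w k) = sep e u w.
Proof. by rewrite /sep /= !c_vtx c_shift. Qed.

Lemma sep_trans e u1 u2 u3 : sep e u1 u3 = sep e u1 u2 (+) sep e u2 u3.
Proof. by rewrite /sep addbA addbK. Qed.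

(** This is acyclicity in usable form: [sep] adds up along a path, so some step has its ends
    separated by [e], and by [sep_ends] that step crosses [e] itself. *)
Lemma sep_path e u p : path adj u p -> sep e u (last u p) ->
  (vtx e.1 e.2 \in u :: p) && (vtx (par e.1) e.2 \in u :: p).
Proof.
elim: p u => [|w p IHp] u; first by rewrite /sep addbb.
case/andP=> /asboolP[v [h [vr E]]] /IHp{}IHp; rewrite (sep_trans _ _ w) /=.
have [|_ /IHp/andP[H1 H2]] := boolP (sep e u w).
  rewrite (sep_ends _ vr E) => /eqP eE _.
  have ev : e.1 = v by case: eE.
  move: eE; rewrite ev => eE.
  rewrite -(vtx_edg e.2) // eE vtx_edg // -(vtxp_edg e.2) // eE vtxp_edg //.
  by case: E => -[-> ->]; rewrite !inE !eqxx ?orbT.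
by rewrite !(in_cons u) H1 H2 !orbT.
Qed.

(** * Connectedness and fixed paths *)

Definition conn u w := exists2 p, path adj u p & last u p = w.

Lemma conn_refl u : conn u u.
Proof. by exists [::]. Qed.

Lemma conn_trans u1 u2 u3 : conn u1 u2 -> conn u2 u3 -> conn u1 u3.
Proof.
by case=> p pp <- [q pq <-]; exists (p ++ q); rewrite ?cat_path ?pp ?last_cat.
Qed.

Lemma conn_sym u w : conn u w -> conn w u.
Proof.
case=> p pp <-; exists (rev (belast u p)).
  by rewrite rev_path (eq_path (e' := adj)) // => x y; rewrite adj_sym.
by case: p {pp} => //= w' p; rewrite rev_cons last_rcons.
Qed.

Lemma conn_act k u w : conn u w -> conn (vact u k) (vact w k).
Proof.
case=> p pp <-; exists (map (vact^~ k) p); last exact: (last_map (vact^~ k)).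
by elim: p u pp => //= w' p IHp u /andP[/(adj_act k)-> /IHp].
Qed.

(** The elements that move the base vertex within its component form a subgroup. It contains each
    [K w], which fixes [vtx w 1]: a path from the base vertex to that vertex and its translate meet
    there. *)
Lemma conn_root v g : conn (vtx r 1) (vtx v g).
Proof.
have base (w : V) : conn (vtx r 1) (vtx w 1).
  elim/(rooted_tree_ind tree): w => [|w wr IHw]; first exact: conn_refl.
  apply: conn_trans IHw _; exists [:: vtx w 1] => //=; rewrite andbT.
  by apply/asboolP; exists w, 1; split=> //; right.
suff rg : conn (vtx r 1) (vtx r g).
  by apply: conn_trans rg _; have := conn_act g (base v); rewrite !vact_vtx !mul1g.
apply: (generated (D := fun g => conn (vtx r 1) (vtx r g))) g.
  split=> [|x y cx cy|x cx]; first exact: conn_refl.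
    by apply: conn_trans cy _; have := conn_act y cx; rewrite !vact_vtx mul1g.
  by apply: conn_sym; have := conn_act x^-1 cx; rewrite !vact_vtx mul1g mulgV.
move=> w x Kx; apply: conn_trans (base w) _; apply: conn_sym.
have := conn_act x (base w); rewrite !vact_vtx !mul1g.
by suff -> : vtx w x = vtx w 1 by []; apply/eqP; rewrite vtx_eq invg1 mulg1.
Qed.

(** If both ends of a simple path are fixed by [P], then so is its first edge, the only edge at [u]
    separating the two ends. Hence the next vertex is fixed, and [Phi] travels along the path. *)
Lemma path_fixed (P : C -> Prop) (Phi : V * C -> Prop) :
  (forall v h, v != r -> (forall x, P x -> L v (h * x * h^-1)) ->
     Phi (vtx v h) <-> Phi (vtx (par v) h)) ->
  forall u p, path adj u p -> uniq (u :: p) ->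
    (forall x, P x -> vact u x = u) ->
    (forall x, P x -> vact (last u p) x = last u p) -> Phi u -> Phi (last u p).
Proof.
move=> step u p; elim: p u => //= w p IHp u /andP[uw wp] /andP[u_wp Uwp] fu fl Pu.
have /asboolP[v [h [vr E]]] := uw.
(* An edge at [u] cannot separate [w] from the last vertex, since the rest of the path would then
   return to [u]. *)
have sep_uw e : ((vtx e.1 e.2 == u) || (vtx (par e.1) e.2 == u)) ->
    sep e u (last w p) = sep e u w.
  move=> ue; rewrite (sep_trans _ _ w).
  have [|_] := boolP (sep e w (last w p)); last by rewrite addbF.
  by case/(sep_path wp)/andP; case/orP: ue => /eqP ->; rewrite (negPf u_wp).
have fixe x : P x -> edg v (h * x) = edg v h.
  move=> Px; apply/eqP; have Ex := ends_act x E.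
  have su : sep (v, h) u w by rewrite (sep_ends _ vr E).
  rewrite -sep_uw in su; last by case: E => -[-> _] /=; rewrite eqxx ?orbT.
  rewrite -(sep_act _ _ _ x) fl // fu //= sep_uw /= in su; last first.
    by move: Ex; rewrite fu // => -[[-> _]|[-> _]] /=; rewrite eqxx ?orbT.
  by rewrite (sep_ends _ vr E) in su.
apply: IHp => // [x Px|].
  have := ends_act x E; rewrite fu // => Ex.
  apply: (ends_fun vr _ E); suff : ends v h u (vact w x) by [].
  move: Ex; rewrite /ends -(vtx_edg (h * x)) // -(vtxp_edg (h * x)) //.
  by rewrite fixe // vtx_edg // vtxp_edg.
have H : Phi (vtx v h) <-> Phi (vtx (par v) h).
  apply: step => // x Px.
  by have /eqP := fixe x Px; rewrite edg_eq eqxx.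
by case: E => -[Eu ->]; apply/H; rewrite -Eu.
Qed.

(** Finite subtrees. [E] consists of all edges with both ends in [X], so it inherits any invariance
    of [X]; [subtree_sep] stands for connectedness: edges outside [E] do not separate vertices of
    [X]. *)
Record subtree (X E : seq (V * C)) : Prop := Subtree {
  subtree_uniqV : uniq X;
  subtree_uniqE : uniq E;
  subtree_size : size X = (size E).+1;
  subtree_vtx : forall u, u \in X -> is_vtx u;
  subtree_edg : forall e, (e \in E) =
    [&& is_edg e, vtx e.1 e.2 \in X & vtx (par e.1) e.2 \in X];
  subtree_sep : forall e u w, is_edg e -> e \notin E ->
    u \in X -> w \in X -> sep e u w = false }.

Lemma subtree_root : subtree [:: vtx r 1] [::].
Proof.
split=> // [u|e|e u w _ _]; rewrite ?inE.
- by move/eqP->; apply: is_vtx_vtx.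
- apply/esym/negP => /and3P[/andP[er _] /eqP/(congr1 fst)/= E _].
  by rewrite E eqxx in er.
- by move=> /eqP -> /eqP ->; apply: addbb.
Qed.

(** A new vertex [w] brings exactly one new edge. A second edge from [w] to some x in [X] would
    separate x from [w], but it separates neither x from [u] nor [u] from [w]. *)
Lemma subtree_add X E u w : subtree X E -> u \in X -> adj u w ->
  exists X' E', subtree X' E' /\ X' =i w :: X.
Proof.
case=> uX uE szX vX eE sX Xu /asboolP[v [h [vr uw]]].
have [Xw|nXw] := boolP (w \in X).
  exists X, E; split=> // x; rewrite inE.
  by case: eqVneq => // ->.
have edge_w e : (vtx e.1 e.2 == w) || (vtx (par e.1) e.2 == w) -> e \notin E.
  rewrite eE => /orP[]/eqP ->; rewrite (negPf nXw) ?andbF //.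
have sep_uw e : is_edg e -> sep e u w = (e == edg v h).
  by case/andP=> _ /eqP E1; rewrite (sep_ends _ vr uw) E1.
have e0E : edg v h \notin E.
  apply: edge_w; rewrite /= vtx_edg // vtxp_edg //.
  by case: uw => -[_ ->]; rewrite eqxx ?orbT.
exists (w :: X), (edg v h :: E); split=> //; split=> //=.
- by rewrite nXw.
- by rewrite e0E.
- by rewrite szX.
- move=> x; rewrite inE => /orP[/eqP ->|/vX //].
  by have [] := ends_vtx uw.
- move=> e; rewrite (in_cons (edg v h)); have [->|ne] /= := eqVneq e (edg v h).
    rewrite is_edg_edg // vtx_edg // vtxp_edg //.
    by case: uw => -[<- <-]; rewrite !inE eqxx Xu !orbT.
  have [eIE|neE] := boolP (e \in E).
    move: eIE; rewrite eE => /and3P[-> e1 e2].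
    by rewrite !inE e1 e2 !orbT.
  apply/esym/negP => /and3P[edge e1 e2].
  have er : e.1 != r by case/andP: edge.
  have [x Xx xw] : exists2 x, x \in X & ends e.1 e.2 x w.
    move: e1 e2; rewrite !inE => /orP[/eqP e1|e1] /orP[/eqP e2|e2].
    - have := par_neq tree er; move: e2; rewrite -e1 => /(congr1 fst)/= ->.
      by rewrite eqxx.
    - by exists (vtx (par e.1) e.2) => //; right.
    - by exists (vtx e.1 e.2) => //; left.
    - by case/negP: neE; rewrite eE edge e1 e2.
  have := sep_ends e er xw; rewrite eqxx (sep_trans _ _ u) sX // sep_uw //.
  by rewrite (negPf ne).
- have sXw e x : is_edg e -> e != edg v h -> e \notin E -> x \in X ->
    sep e x w = false.
    move=> edge ne neE Xx; rewrite (sep_trans _ _ u) sX // sep_uw //.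
    exact: negbTE.
  move=> e x y edge; rewrite !inE negb_or => /andP[ne neE].
  case/orP=> [/eqP ->|Xx] /orP[/eqP ->|Xy].
  - exact: addbb.
  - by rewrite /sep addbC; apply: sXw.
  - exact: sXw.
  - exact: sX.
Qed.

Lemma subtree_path X E u p : subtree X E -> u \in X -> path adj u p ->
  exists X' E', subtree X' E' /\ X' =i p ++ X.
Proof.
elim: p X E u => [|w p IHp] X E u st Xu /=; first by exists X, E.
case/andP=> uw wp; have [X1 [E1 [st1 X1E]]] := subtree_add st Xu uw.
have [||X2 [E2 [st2 X2E]]] := IHp _ _ w st1; first by rewrite X1E mem_head.
  by [].
exists X2, E2; split=> // x; rewrite X2E !(inE, mem_cat) X1E inE.
by rewrite orbCA.
Qed.

Lemma subtree_paths X E (ps : seq (V * C * seq (V * C))) : subtree X E ->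
  (forall q, q \in ps -> q.1 \in X /\ path adj q.1 q.2) ->
  exists X' E', subtree X' E' /\ X' =i flatten (map snd ps) ++ X.
Proof.
elim: ps X E => [|q ps IHps] X E st Hps /=; first by exists X, E.
have [Xq pq] := Hps q (mem_head _ _).
have [X1 [E1 [st1 X1E]]] := subtree_path st Xq pq.
have [q' q'ps|X2 [E2 [st2 X2E]]] := IHps _ _ st1.
  have [Xq' ?] := Hps q' (mem_behead (s := q :: ps) q'ps).
  by split=> //; rewrite X1E mem_cat Xq' orbT.
exists X2, E2; split=> // x; rewrite X2E !mem_cat X1E mem_cat.
by rewrite orbCA orbA.
Qed.

(** The subtree is the union of all translates by [P] of chosen paths from the base vertex to its
    translates by [P]. *)
Lemma finite_subgroup_subtree (P : C -> Prop) (s : seq C) :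
  is_subgroup P -> (forall x, P x <-> x \in s) ->
  exists X E, subtree X E /\ (forall u x, u \in X -> P x -> vact u x \in X).
Proof.
case=> P1 PM PV Ps; pose o := vtx r 1.
have paths g : exists q, path adj o q /\ last o q = vtx r g.
  by have [q] := conn_root r g; exists q.
have [gam gamP] := choice paths.
(* The paths starting at [o] are added first: they reach the translates of [o], where the translated
   paths of [ps2] start. *)
pose ps1 := [seq (o, gam g) | g <- s].
pose ps2 := [seq (vtx r h, map (vact^~ h) (gam g)) | g <- s, h <- s].
have [q|X1 [E1 [st1 X1E]]] := subtree_paths (ps := ps1) subtree_root.
  by case/mapP=> g _ -> /=; rewrite mem_head; have [] := gamP g.
have X1o g : P g -> vtx r g \in X1.
  move=> Pg; rewrite X1E mem_cat inE orbC; have [_ <-] := gamP g.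
  have := mem_last o (gam g); rewrite inE; case/orP=> [-> //|lg].
  apply/orP; right; apply/flattenP; exists (gam g) => //.
  by rewrite -map_comp; apply/mapP; exists g => //; apply/Ps.
have [q|X2 [E2 [st2 X2E]]] := subtree_paths (ps := ps2) st1.
  case/allpairsP=> -[g h] [/= sg sh ->] /=; split; first exact/X1o/Ps.
  have [pg _] := gamP g; have : vact o h = vtx r h by rewrite vact_vtx mul1g.
  move=> <-; elim: (gam g) (o) pg => //= w t IHt u /andP[uw wt].
  by rewrite adj_act //= IHt.
have X2P u : u \in X2 <->
    exists g h, [/\ P g, P h & u \in map (vact^~ h) (o :: gam g)].
  split=> [Xu|[g [h [Pg Ph]]]]; last first.
    rewrite X2E mem_cat inE => /orP[/eqP->|uq].
      by rewrite [vact^~ h o]vact_vtx mul1g X1o ?orbT.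
    apply/orP; left; apply/flattenP; exists (map (vact^~ h) (gam g)) => //.
    rewrite map_allpairs /=; apply/allpairsP; exists (g, h).
    by split=> //; apply/Ps.
  have vu := subtree_vtx st2 Xu; have u1 := vact1 vu.
  move: Xu; rewrite X2E mem_cat => /orP[/flattenP[q]|].
    rewrite map_allpairs => /allpairsP[[g h] [/= /Ps sg /Ps sh ->]] uq.
    by exists g, h; split; rewrite // in_cons uq orbT.
  rewrite X1E mem_cat inE => /orP[/flattenP[q]|/eqP uo]; last first.
    by exists 1, 1; split=> //; apply/mapP; exists u; rewrite ?u1 // uo mem_head.
  rewrite -map_comp => /mapP[g /Ps Pg ->] uq; exists g, 1; split=> //.
  by apply/mapP; exists u; rewrite ?u1 // in_cons uq orbT.
exists X2, E2; split=> // u x /X2P[g [h [Pg Ph /mapP[w wq ->]]]] Px.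
by apply/X2P; exists g, (h * x); split; rewrite ?vactM //; [apply: PM | apply/mapP; exists w].
Qed.

Lemma finite_pgroup_fixes_vertex (p : nat) (P : C -> Prop) :
  prime p -> finite_p_subgroup p P ->
  exists2 u, is_vtx u & forall x, P x -> vact u x = u.
Proof.
move=> p_pr fP; apply: contrapT => nofix.
have move_vtx u : is_vtx u -> exists2 x, P x & vact u x <> u.
  move=> vu; apply: contrapT => fixu; apply: nofix; exists u => // x Px.
  by apply: contrapT => ux; apply: fixu; exists x.
have [gP [s [_ Ps _]]] := fP.
have [X [E [st aX]]] := finite_subgroup_subtree gP Ps.
have edgeE e : e \in E ->
    [/\ e.1 != r, is_edg e, vtx e.1 e.2 \in X & vtx (par e.1) e.2 \in X].
  by rewrite (subtree_edg st) => /and3P[eE ? ?]; split=> //; case/andP: eE.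
have dvdX : p %| size X.
  apply: (pgroup_dvd_size (a := vact) p_pr fP (subtree_uniqV st) aX).
  - by move=> u /(subtree_vtx st)/vact1.
  - by move=> *; apply: vactM.
  - by move=> u /(subtree_vtx st)/move_vtx.
have dvdE : p %| size E.
  apply: (pgroup_dvd_size (a := eact) p_pr fP (subtree_uniqE st)).
  - move=> e x /edgeE[er _ e1 e2] Px; rewrite (subtree_edg st) is_edg_edg //=.
    by rewrite vtx_edg // vtxp_edg // -!vact_vtx !aX.
  - by move=> e /edgeE[_ eE _ _]; apply: eact1.
  - by move=> *; apply: eactM.
  (* An element fixing an edge fixes its end of type [e.1], and every vertex is moved by some
     element of [P]. *)
  - move=> e /edgeE[er _ e1 _].
    have [x Px ne] := move_vtx _ (subtree_vtx st e1); exists x => // ex.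
    by apply: ne; rewrite vact_vtx -vtx_edg // -[in RHS]ex.
move: dvdX; rewrite (subtree_size st) -addn1 dvdn_addr // dvdn1 => /eqP p1.
by rewrite p1 in p_pr.
Qed.

End BassSerreTree.

(** * Homomorphisms defined on a subgroup *)

Section HomOn.
Variables (gT : finGroupType) (C : groupType) (A : {group gT}) (f : gT -> C).
Hypothesis fM : hom_on A f.

Lemma hom_on1 : f 1 = 1.
Proof. by apply: (mulgI (f 1)); rewrite -fM ?mulg1. Qed.

Lemma hom_onV x : x \in A -> f x^-1 = (f x)^-1.
Proof.
by move=> Ax; apply: (mulgI (f x)); rewrite -fM ?groupV // !mulgV hom_on1.
Qed.

Lemma hom_onJ x y : x \in A -> y \in A -> f (x ^ y) = f x ^ f y.
Proof. by move=> Ax Ay; rewrite !conjgE !fM ?groupM ?groupV // hom_onV. Qed.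

Definition im_on : pred C := [pred z | [exists x in A, f x == z]].

Lemma im_onP z : reflect (exists2 x, x \in A & f x = z) (im_on z).
Proof.
apply: (iffP existsP) => [[x /andP[Ax /eqP fx]]|[x Ax fx]]; exists x => //.
by rewrite Ax fx eqxx.
Qed.

Lemma im_on_subgroup : is_subgroup (fun z => im_on z).
Proof.
split=> [|z w /im_onP[x Ax <-] /im_onP[y Ay <-]|z /im_onP[x Ax <-]]; apply/im_onP.
- by exists 1; rewrite ?hom_on1.
- by exists (x * y); rewrite ?groupM ?fM.
- by exists x^-1; rewrite ?groupV ?hom_onV.
Qed.

End HomOn.

(** * Free actions *)

Section FreeActions.
Variables (aT : finGroupType) (A : {group aT}) (T : finType).

Definition free_on (a : aT -> {perm T}) : Prop :=
  hom_on A a /\ forall x t, x \in A -> a x t = t -> x = 1.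

Lemma free_on_inj a t : free_on a -> {in A &, injective (fun x => a x t)}.
Proof.
case=> aM fa x y Ax Ay axy; apply: (mulIg y^-1); rewrite mulgV.
apply: (fa _ t); rewrite ?groupM ?groupV //.
by rewrite aM ?groupV // permM axy (hom_onV aM) // permK.
Qed.

(* Match one A-orbit of U with one of W and induct on the number of points. *)
Lemma free_on_match a b (U W : {set T}) : free_on a -> free_on b ->
  (forall x t, x \in A -> t \in U -> a x t \in U) ->
  (forall x t, x \in A -> t \in W -> b x t \in W) -> #|U| = #|W| ->
  exists s : T -> T, [/\ {in U &, injective s}, {in U, forall t, s t \in W} &
    forall x t, x \in A -> t \in U -> s (a x t) = b x (s t)].
Proof.
move=> fa fb; have [n] := ubnP #|U|; elim: n U W => // n IHn U W ltUn aU bW UW.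
have [->|[u Uu]] := set_0Vmem U.
  by exists id; split=> [t t'|t|x t]; rewrite inE.
have [w Ww] : exists w, w \in W.
  by apply/card_gt0P; rewrite -UW; apply/card_gt0P; exists u.
pose Ou := [set a x u | x in A]; pose Ow := [set b x w | x in A].
have [[aM fa1] [bM fb1]] := (fa, fb).
have a1 : a 1 = 1 := hom_on1 aM.
have b1 : b 1 = 1 := hom_on1 bM.
have sOU : Ou \subset U by apply/subsetP => _ /imsetP[x Ax ->]; apply: aU.
have sOW : Ow \subset W by apply/subsetP => _ /imsetP[x Ax ->]; apply: bW.
have cO : #|Ou| = #|Ow|.
  rewrite !card_in_imset //; exact: free_on_inj.
have Ou_u : u \in Ou by apply/imsetP; exists 1; rewrite ?a1 ?perm1.
have outU x t : x \in A -> t \in U :\: Ou -> a x t \in U :\: Ou.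
  move=> Ax /setDP[Ut nt]; rewrite inE aU // andbT.
  apply: contra nt => /imsetP[y Ay axt]; apply/imsetP; exists (y * x^-1).
    by rewrite groupM ?groupV.
  by rewrite aM ?groupV // permM -axt (hom_onV aM) // permK.
have outW x t : x \in A -> t \in W :\: Ow -> b x t \in W :\: Ow.
  move=> Ax /setDP[Ut nt]; rewrite inE bW // andbT.
  apply: contra nt => /imsetP[y Ay bxt]; apply/imsetP; exists (y * x^-1).
    by rewrite groupM ?groupV.
  by rewrite bM ?groupV // permM -bxt (hom_onV bM) // permK.
have cUW : #|U :\: Ou| = #|W :\: Ow|.
  by rewrite !cardsD (setIidPr sOU) (setIidPr sOW) UW cO.
have ltU : #|U :\: Ou| < n.
  apply: leq_trans (_ : #|U| <= n) => //; apply: proper_card.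
  by apply/properP; split; [apply: subsetDl | exists u; rewrite // inE Ou_u].
have [s [s_inj sW sE]] := IHn _ _ ltU outU outW cUW.
(* On the orbit of [u] the map is forced by equivariance and well defined by freeness; elsewhere the
   inductive map is kept. *)
pose s' t := if [pick x in A | a x u == t] is Some x then b x w else s t.
have s'in x : x \in A -> s' (a x u) = b x w.
  move=> Ax; rewrite /s'; case: pickP => [y /andP[Ay /eqP/(free_on_inj fa)->] //|].
  by move/(_ x); rewrite Ax eqxx.
have s'out t : t \notin Ou -> s' t = s t.
  move=> nt; rewrite /s'; case: pickP => // x /andP[Ax /eqP axt].
  by case/imsetP: nt; exists x.
have s'W t : t \in U -> s' t \in Ow = (t \in Ou).
  move=> Ut; have [/imsetP[x Ax ->]|nt] := boolP (t \in Ou).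
    by rewrite s'in //; apply/imsetP; exists x.
  rewrite s'out //; apply: negbTE.
  have : s t \in W :\: Ow by apply: sW; rewrite inE nt.
  by case/setDP.
exists s'; split.
- move=> t t' Ut Ut' ss; have := s'W t' Ut'; rewrite -ss s'W //.
  have [/imsetP[x Ax tx]|nt] := boolP (t \in Ou).
    move/esym/imsetP => [y Ay ty]; move: ss; rewrite tx ty !s'in //.
    by move/(free_on_inj fb)->.
  move/esym/negbT=> nt'; move: ss; rewrite !s'out //.
  by apply: s_inj; rewrite inE ?nt ?nt'.
- move=> t Ut; have [/imsetP[x Ax ->]|nt] := boolP (t \in Ou).
    by rewrite s'in // bW.
  have : s t \in W :\: Ow by apply: sW; rewrite inE nt.
  by rewrite s'out // => /setDP[].
- move=> x t Ax Ut; have [/imsetP[y Ay ->]|nt] := boolP (t \in Ou).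
    by rewrite -permM -aM // !s'in ?groupM // bM // permM.
  have tO : t \in U :\: Ou by rewrite inE nt.
  have /setDP[_ ?] := outU x t Ax tO.
  by rewrite !s'out // sE.
Qed.

(** Both actions decompose [T] into the same number of regular orbits. This lets the two actions of
    an edge group, through its two vertex groups, be made equal. *)
Lemma free_on_conj a b : free_on a -> free_on b ->
  exists s : {perm T}, forall x, x \in A -> b x = a x ^ s.
Proof.
move=> fa fb.
have [||//|s [s_inj _ sE]] := free_on_match (U := setT) (W := setT) fa fb.
- by move=> *; rewrite inE.
- by move=> *; rewrite inE.
have si : injective s by move=> t t'; apply: s_inj; rewrite inE.
exists (perm si) => x Ax; apply: (mulgI (perm si)).
apply/permP => t; rewrite -conjgC !permM !permE sE ?inE //.
Qed.

End FreeActions.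

(* On the product of all gT v, let gT v multiply the coordinate v. *)
Lemma free_actions_on_product (V : finType) (gT : V -> finGroupType) :
  exists (T : finType) (_ : T) (a : forall v, gT v -> {perm T}),
    forall v, free_on [set: gT v] (a v).
Proof.
pose T := {dffun forall v, gT v}.
pose m v (x : gT v) (t : T) : T := [ffun w => dfwith t (t v * x) w].
have m1 v t : m v 1 t = t.
  by apply/ffunP => w; rewrite ffunE mulg1; case: dfwithP.
have mM v (x y : gT v) t : m v (x * y) t = m v y (m v x t).
  apply/ffunP => w; rewrite /m !ffunE dfwith_in mulgA.
  have [<-|vw] := eqVneq v w; first by rewrite !dfwith_in.
  by rewrite !dfwith_out // ffunE dfwith_out.
have mK v (x : gT v) : injective (m v x).
  by apply: (can_inj (g := m v x^-1)) => t; rewrite -mM mulgV m1.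
exists T, [ffun v => 1], (fun v x => perm (@mK v x)) => v; split=> [x y _ _|x t _].
  by apply/permP => t; rewrite permM !permE mM.
rewrite permE => /ffunP/(_ v); rewrite ffunE dfwith_in => tx.
by apply: (mulgI (t v)); rewrite tx mulg1.
Qed.
(** * The completion of a tree of groups *)

Section Completion.
Variables (V : finType) (r : V) (par : V -> V).
Variables (gT eT : V -> finGroupType).
Variables (G : forall v, {group gT v}) (Ge : forall v, {group eT v}).
Variables (fd : forall v, {morphism Ge v >-> gT v}).
Variables (fu : forall v, {morphism Ge v >-> gT (par v)}).
Variables (C : groupType) (iv : forall v, gT v -> C).
Arguments iv : clear implicits.
Hypothesis tog : tree_of_groups r G fd fu.
Hypothesis compl : is_completion r G fd fu iv.

Let tree : rooted_tree r par := tog.1.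

Lemma ivM v : hom_on (G v) (iv v).
Proof. exact: compl.1.1. Qed.

Lemma iv_edge v x : v != r -> x \in Ge v -> iv v (fd v x) = iv (par v) (fu v x).
Proof. by move=> vr; apply: compl.1.2. Qed.

Lemma fdG v x : v != r -> x \in Ge v -> fd v x \in G v.
Proof.
by move=> vr Gx; have [_ _ /subsetP sd _] := tog.2 v vr; apply: sd; apply: mem_morphim.
Qed.

Lemma fuG v x : v != r -> x \in Ge v -> fu v x \in G (par v).
Proof.
by move=> vr Gx; have [_ _ _ /subsetP su] := tog.2 v vr; apply: su; apply: mem_morphim.
Qed.

Lemma completion_unique (H : groupType) (f1 f2 : C -> H) :
  group_hom f1 -> group_hom f2 ->
  (forall v x, x \in G v -> f1 (iv v x) = f2 (iv v x)) -> f1 =1 f2.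
Proof.
move=> f1M f2M f12.
have [|phi [_ _ uniq_phi]] := compl.2 H (fun v x => f1 (iv v x)).
  split=> [v x y Gx Gy|v vr x Gx]; first by rewrite ivM.
  by rewrite iv_edge.
move=> z; rewrite (uniq_phi f1) // (uniq_phi f2) // => v x Gx.
by rewrite f12.
Qed.

(* The inner automorphism of C |x F_2^C given by the indicator of D fixes the
   vertex groups, hence all of C, so D is invariant under translation by C. *)
Lemma completion_generated (D : C -> Prop) : is_subgroup D ->
  (forall v x, x \in G v -> D (iv v x)) -> forall g, D g.
Proof.
case=> D1 DM DV Div.
pose m : unit -> C -> bool := fun _ h => `[< D h >].
pose f1 g : affine unit C := (g, fun _ _ => false).
pose f2 g : affine unit C := (g, labadd (shift m g) m).
have f1M : group_hom f1 by move=> g h; apply: affineP.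
have f2M : group_hom f2.
  move=> g h; apply: affineP => //= i k.
  rewrite /labadd /shift invgM mulgA.
  by do 3!case: (m i _).
have f12 := completion_unique f1M f2M.
have {}f12 g : f1 g = f2 g.
  apply: f12 => v x Gx; apply: affineP => //= i h.
  apply/esym; rewrite /labadd /shift /m; apply/negbTE; rewrite negb_add.
  apply/eqP/asbool_equiv_eq; split=> [|Dh].
    by move/(DM _ _)/(_ (Div _ _ Gx)); rewrite mulgVK.
  by apply: DM => //; apply/DV/Div.
(* At [g] the translated indicator takes its value at 1, which is true; equality with the zero
   function forces [D g]. *)
move=> g; have := congr1 (fun a : affine unit C => a.2 tt g) (f12 g).
rewrite /= /labadd /shift mulgV /m (asboolT D1) => /esym/negbT.
by rewrite negb_add eq_sym eqb_id => /asboolP.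
Qed.

Definition vgrp v : pred C := im_on (G v) (iv v).
(* There is no edge at r, where fd r is junk. *)
Definition egrp v : pred C := fun z =>
  if v == r then z == 1 else im_on (Ge v) (fun x => iv v (fd v x)) z.

Lemma vgrpP v z : reflect (exists2 x, x \in G v & iv v x = z) (vgrp v z).
Proof. exact: im_onP. Qed.

Lemma egrpP v z : v != r ->
  reflect (exists2 x, x \in Ge v & iv v (fd v x) = z) (egrp v z).
Proof. by move=> vr; rewrite /egrp (negPf vr); apply: im_onP. Qed.

Lemma vgrp_subgroup v : is_subgroup (fun z => vgrp v z).
Proof. exact/im_on_subgroup/ivM. Qed.

Lemma egrp_subgroup v : is_subgroup (fun z => egrp v z).
Proof.
rewrite /egrp; have [_|vr] := eqVneq v r.
  by split=> [|x y /eqP-> /eqP->|x /eqP->]; rewrite ?mulg1 ?invg1.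
apply: im_on_subgroup => x y Gx Gy /=.
by rewrite morphM // ivM ?fdG.
Qed.

Lemma egrp_vgrp v z : v != r -> egrp v z -> vgrp v z.
Proof.
move=> vr /(egrpP _ vr)[x Gx <-]; apply/vgrpP; exists (fd v x) => //.
exact: fdG.
Qed.

Lemma egrp_vgrpp v z : v != r -> egrp v z -> vgrp (par v) z.
Proof.
move=> vr /(egrpP _ vr)[x Gx <-]; apply/vgrpP; exists (fu v x).
  exact: fuG.
by rewrite iv_edge.
Qed.

Lemma vgrp_generated (D : C -> Prop) : is_subgroup D ->
  (forall v z, vgrp v z -> D z) -> forall g, D g.
Proof.
move=> gD DG; apply: completion_generated => // v x Gx.
by apply: (DG v); apply/vgrpP; exists x.
Qed.

(* With t v the sum of the edges on the path from r to v, the cocycles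
   x |-> t v * x - t v on the vertex groups agree on edge groups; they glue to a
   cocycle d on C, and c v g := t v * g + d g is the path from the base vertex to
   the vertex (v, g) of the Bass-Serre tree. *)
Lemma path_cocycle : exists c : V -> C -> V -> C -> bool,
  [/\ forall v x g, vgrp v x -> c v (x * g) = c v g,
      forall v g w h, v != r ->
        c v g w h (+) c (par v) g w h = (w == v) && egrp v (h * g^-1) &
      forall v g v' g' k w h,
        c v (g * k) w (h * k) (+) c v' (g' * k) w (h * k) =
        c v g w h (+) c v' g' w h].
Proof.
pose edge v : V -> C -> bool := fun w h => (w == v) && egrp v h.
have [t [_ tP]] := rooted_tree_rec tree (fun _ _ => false) (fun v => labadd (edge v)).
pose j v x : affine V C := (iv v x, labadd (t v) (shift (t v) (iv v x))).
have [|f [fM fj _]] := compl.2 (affine V C) j.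
  split=> [v x y Gx Gy|v vr x Gx]; apply: affineP => [|w h] /=.
  - exact: ivM.
  - rewrite ivM // /labadd /shift invgM mulgA.
    by do 3!case: (t v w _).
  - exact: iv_edge.
  - rewrite -iv_edge // tP // /labadd /shift /edge.
    (* The functions [t v] and [t (par v)] differ by the indicator of the edge group, which
       translation by an element of that group preserves. *)
    suff -> : egrp v (h * (iv v (fd v x))^-1) = egrp v h.
      by case: (_ && _); do 2!case: (t (par v) w _).
    have [_ gM gV] := egrp_subgroup v.
    have ex : egrp v (iv v (fd v x)) by apply/egrpP => //; exists x.
    apply/idP/idP => [/gM/(_ ex)|/gM]; first by rewrite mulgVK.
    by apply; apply: gV.
(* By uniqueness [f] is a section of the projection to [C], so its second component is a cocycle. *)
have f1 g : (f g).1 = g.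
  apply: (completion_unique (f1 := fun g => (f g).1) (f2 := id)) => //.
    by move=> x y; rewrite fM.
  by move=> v x Gx; rewrite fj.
pose d g := (f g).2.
have dM g h : d (g * h) = labadd (shift (d g) h) (d h).
  by rewrite /d fM /= f1.
exists (fun v g => labadd (shift (t v) g) (d g)); split.
- move=> v _ g /vgrpP[x Gx <-]; apply/funext => w; apply/funext => h.
  rewrite dM /d fj //= /labadd /shift invgM mulgA.
  by do 2!case: (t v w _); case: ((f g).2 w h).
- move=> v g w h vr; rewrite tP // /labadd /shift /edge.
  set a := _ && _; set b := t _ _ _; set e := d _ _ _.
  by case: a b e => [] [] [].
- move=> v g v' g' k w h; rewrite !dM /labadd /shift !invgM !mulgA.
  rewrite mulgK; set a := t _ _ _; set b := t _ _ _.
  by case: a b (d g w h) (d g' w h) (d k w _) => [] [] [] [] [].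
Qed.

(** Free actions of all vertex groups on one set, suitably conjugated, form a cocone into
    [{perm T}]. The induced homomorphism on [C] is faithful on each vertex group. *)
Lemma iv_inj v : {in G v &, injective (iv v)}.
Proof.
have [T [t0 [a fa]]] := free_actions_on_product gT.
have faG w : free_on (G w) (a w).
  have [aM fa1] := fa w; split=> [x y _ _|x t _]; first by rewrite aM ?inE.
  by apply: fa1; rewrite inE.
have conj_ex w : exists s : {perm T}, w != r ->
    forall x, x \in Ge w -> a (par w) (fu w x) = a w (fd w x) ^ s.
  have [->|wr] := eqVneq w r; first by exists 1.
  have [injd inju _ _] := tog.2 w wr.
  have [||s sP] := @free_on_conj _ (Ge w) T (fun x => a w (fd w x))
                     (fun x => a (par w) (fu w x)).
  - split=> [x y Gx Gy|x t Gx /(faG w).2]; first by rewrite morphM // (faG w).1 ?fdG.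
    by move/(_ (fdG wr Gx))/eqP; rewrite morph_injm_eq1 // => /eqP.
  - split=> [x y Gx Gy|x t Gx /(faG (par w)).2].
      by rewrite morphM // (faG (par w)).1 ?fuG.
    by move/(_ (fuG wr Gx))/eqP; rewrite morph_injm_eq1 // => /eqP.
  by exists s => _.
have [s sP] := choice conj_ex.
(* The conjugators of the edges are multiplied along the path to the root, so that the corrected
   actions agree on every edge group. *)
have [t [_ tP]] := rooted_tree_rec tree 1 (fun w q => s w * q).
have [|f [fM fj _]] := compl.2 {perm T} (fun w x => a w x ^ t w).
  split=> [w x y Gx Gy|w wr x Gx]; first by rewrite (faG w).1 // conjMg.
  by rewrite tP // conjgM -sP.
move=> x y Gx Gy /(congr1 f); rewrite !fj // => /conjg_inj axy.
by apply: (free_on_inj (t := t0) (faG v)) => //; rewrite axy.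
Qed.

Lemma completion_conn v g :
  conn r par vgrp (vtx vgrp r 1) (vtx vgrp v g).
Proof.
exact: conn_root tree vgrp_subgroup vgrp_generated v g.
Qed.

(** * Fusion *)

Variables (p : nat) (Sv : forall v, {group gT v}) (Se : forall v, {group eT v}).
Variables (gd : forall v, gT v) (gu : forall v, gT (par v)).
Variable iota : forall v, gT v -> gT r.
Arguments iota : clear implicits.
Hypothesis p_pr : prime p.
Hypothesis tofs : induced_tree_of_fusion_systems p r G fd fu Sv Se gd gu.
Hypothesis hypH : hypothesis_H r par fd Sv Se gd.
Hypothesis ident : identification fd fu Sv Se gd gu iota.

Lemma sylSv v : p.-Sylow(G v) (Sv v).
Proof. by have := tofs.1 v; rewrite inE. Qed.

Lemma SvG v x : x \in Sv v -> x \in G v.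
Proof. exact/subsetP/(pHall_sub (sylSv v)). Qed.

Lemma Se_edge v : v != r ->
  [/\ p.-Sylow(Ge v) (Se v), gd v \in G v, gu v \in G (par v),
      forall x, x \in Se v -> fd v x ^ gd v \in Sv v &
      forall x, x \in Se v -> fu v x ^ gu v \in Sv (par v)].
Proof.
move=> vr; have [] := tofs.2 v vr; rewrite inE => sylS gdG guG /subsetP sd /subsetP su.
have SG := subsetP (pHall_sub sylS).
by split=> // x Sx; [apply: sd | apply: su]; rewrite memJ_conjg mem_morphim ?SG.
Qed.

(** By (H) each element of S(v) comes from the edge towards the root, so the equation for [iota]
    reduces v to its parent; in [C] the two images of the edge group coincide, and only conjugations
    remain. Injectivity and multiplicativity of [iota] follow from this. *)
Lemma iota_conj v : exists h : C, forall x, x \in Sv v ->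
  iota v x \in Sv r /\ iv r (iota v x) = iv v x ^ h.
Proof.
elim/(rooted_tree_ind tree): v => [|v vr [h hP]].
  by exists 1 => x Sx; rewrite conjg1 ident.1.
have [sylS gdG guG sd su] := Se_edge vr; have SG := subsetP (pHall_sub sylS).
exists ((iv v (gd v))^-1 * (iv (par v) (gu v) * h)) => x.
rewrite -(hypH vr) => /imsetP[_ /morphimP[y _ Sy ->] ->].
rewrite ident.2 //; have [-> ->] := hP _ (su y Sy); split=> //.
have Gy := SG _ Sy; rewrite !(hom_onJ (@ivM _)) ?fdG ?fuG //.
by rewrite conjgM conjgK iv_edge // conjgM.
Qed.

Lemma iota_S v x : x \in Sv v -> iota v x \in Sv r.
Proof. by move=> Sx; have [h hP] := iota_conj v; have [] := hP x Sx. Qed.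

Lemma iota_inj v : {in Sv v &, injective (iota v)}.
Proof.
move=> x y Sx Sy; have [h hP] := iota_conj v => /(congr1 (iv r)).
have [_ ->] := hP x Sx; have [_ ->] := hP y Sy => /conjg_inj.
by apply: iv_inj; apply: SvG.
Qed.

Lemma iotaM v : {in Sv v &, {morph iota v : x y / x * y}}.
Proof.
move=> x y Sx Sy; have [h hP] := iota_conj v.
have [Sx' ex] := hP x Sx; have [Sy' ey] := hP y Sy.
have [Sxy' exy] := hP _ (groupM Sx Sy).
apply: (@iv_inj r); rewrite ?groupM ?SvG //.
by rewrite ivM ?SvG // ex ey exy ivM ?SvG // conjMg.
Qed.

Lemma iota_root x : x \in Sv r -> iota r x = x.
Proof. exact: ident.1. Qed.

Local Notation FC := (completion_fusion Sv iv).

Lemma completion_fusion_system : is_fusion_system (Sv r) FC.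
Proof.
have homFC (P Q : {group gT r}) (phi : gT r -> gT r) : FC P Q phi ->
    {in P &, {morph phi : x y / x * y}} /\ {in P &, injective phi}.
  case=> /subsetP sPS /subsetP sQS [g gP].
  have PG x : x \in P -> x \in G r by move/sPS/SvG.
  have phiG x : x \in P -> phi x \in G r by move/gP => -[/sQS/SvG].
  split=> [x y Px Py|x y Px Py].
    apply: (@iv_inj r); rewrite ?groupM ?phiG ?groupM //.
    rewrite (gP _ (groupM Px Py)).2 [RHS]ivM ?phiG // (gP x Px).2 (gP y Py).2.
    by rewrite ivM ?PG // conjMg.
  move/(congr1 (iv r)); rewrite (gP x Px).2 (gP y Py).2 => /conjg_inj.
  by apply: iv_inj; apply: PG.
split.
- move=> P Q phi psi ephi [sP sQ [g gP]]; split=> //; exists g => x Px.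
  by rewrite -ephi //; apply: gP.
- move=> P Q phi Fphi; have [phiM phi_inj] := homFC _ _ _ Fphi.
  by case: Fphi => sP sQ [g gP]; split=> // x /gP[].
- move=> P Q g sP sQ Sg /subsetP sPQ; split=> //; exists (iv r g) => x Px.
  split; first by apply: sPQ; rewrite memJ_conjg.
  by rewrite (hom_onJ (@ivM r)) // SvG // (subsetP sP).
- move=> P Q R phi psi [sP sQ [g gP]] [_ sR [h hP]]; split=> //.
  exists (g * h) => x Px; have [Qx ex] := gP x Px; have [Rx ey] := hP _ Qx.
  by rewrite Rx ey ex conjgM.
- move=> P Q R phi Fphi eR; have [phiM phi_inj] := homFC _ _ _ Fphi.
  case: Fphi => sP sQ [g gP].
  have sR : R \subset Sv r.
    rewrite eR; apply/subsetP => _ /imsetP[x Px ->].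
    by apply: (subsetP sQ); have [] := gP x Px.
  split; first split=> //.
    by exists g => x Px; rewrite (gP x Px).2 eR imset_f.
  (* The inverse of [phi] on its image, with default 1 elsewhere; it is induced by [g^-1]. *)
  pose psi y := odflt 1 [pick x in P | phi x == y].
  have psiK x : x \in P -> psi (phi x) = x.
    move=> Px; rewrite /psi; case: pickP => [y /andP[Py /eqP/phi_inj->]//|].
    by move/(_ x); rewrite Px eqxx.
  exists psi; split=> //; split=> //; exists g^-1 => y.
  rewrite eR => /imsetP[x Px ->]; rewrite psiK //; split=> //.
  by rewrite (gP x Px).2 conjgK.
Qed.

Lemma completion_fusion_vertices : contains_vertex_fusion G Sv iota FC.
Proof.
move=> v _ P' T' g phi P0 sP0 Gg sP0g eP' eT' phiP.
have iotaS (A : {set gT v}) : A \subset Sv v -> iota v @: A \subset Sv r.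
  by move=> /subsetP sA; apply/subsetP => _ /imsetP[x /sA/iota_S Sx ->].
split; [by rewrite eP' iotaS | by rewrite eT' iotaS |].
(* As [iota v] is conjugation by [h], it turns conjugation by [g] into conjugation by its
   [h]-conjugate. *)
have [h hP] := iota_conj v; exists (h^-1 * (iv v g * h)) => x.
rewrite eP' => /imsetP[y Py ->]; rewrite phiP //.
have Sy := subsetP sP0 y Py.
have Syg : y ^ g \in Sv v by rewrite (subsetP sP0g) ?memJ_conjg.
rewrite eT' imset_f //; split=> //.
rewrite (hP _ Syg).2 (hP _ Sy).2 (hom_onJ (@ivM v)) ?(SvG Sy) //.
by rewrite conjgM conjgK conjgM.
Qed.

Lemma completion_sylow (P : C -> Prop) : finite_p_subgroup p P ->
  exists g : C, forall x, P x -> exists y, y \in Sv r /\ iv r y = x ^ g.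
Proof.
move=> fP; have [c [c1 c2 _]] := path_cocycle.
have [[v g] /eqP vg fixu] := finite_pgroup_fixes_vertex tree vgrp_subgroup
  egrp_subgroup egrp_vgrp egrp_vgrpp vgrp_generated c1 c2 p_pr fP.
have PG x : P x -> exists2 y, y \in G v & iv v y = x ^ g^-1.
  move/fixu => /eqP; rewrite -vg vact_vtx /=; last exact: vgrp_subgroup.
  rewrite vtx_eq; last exact: vgrp_subgroup.
  by move=> /vgrpP[y Gy ey]; exists y; rewrite // ey conjgE invgK mulgA.
have [[P1 PM PV] [s [us Ps [k szs]]]] := fP.
(* The fixed vertex gives P <= G(v)^g; [R] is the copy of [P] inside G(v), of the same order because
   [iv v] is injective. *)
pose R := [set y in G v | (iv v y) ^ g \in s].
have RP y : y \in R <-> y \in G v /\ P (iv v y ^ g).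
  by rewrite inE; split=> [/andP[? /Ps]|[-> /Ps]].
have gR : group_set R.
  apply/group_setP; split; first by apply/RP; rewrite (hom_on1 (@ivM v)) conj1g.
  move=> x y /RP[Gx Px] /RP[Gy Py]; apply/RP; rewrite groupM // ivM // conjMg.
  by split=> //; apply: PM.
have sizeR : size s = #|R|.
  rewrite cardE -(size_map (fun y => iv v y ^ g)); apply: perm_size.
  apply: uniq_perm => //.
    rewrite map_inj_in_uniq ?enum_uniq // => x y /[!mem_enum] /RP[Gx _] /RP[Gy _].
    by move/conjg_inj; apply: iv_inj.
  move=> x; apply/idP/mapP => [/Ps Px|[y /[!mem_enum] /RP[_ /Ps ?] ->] //].
  have [y Gy xy] := PG x Px; exists y; last by rewrite xy conjgKV.
  by rewrite mem_enum; apply/RP; rewrite xy conjgKV.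
have pR : p.-group (Group gR) by rewrite /pgroup /= -sizeR szs pnatX pnat_id.
have sRG : Group gR \subset G v by apply/subsetP => y /RP[].
have [m Gm /subsetP RSm] := Sylow_subJ (sylSv v) sRG pR.
have [h hP] := iota_conj v; exists (g^-1 * (iv v m^-1 * h)) => x Px.
have [y Gy xy] := PG x Px.
have Sy : y ^ m^-1 \in Sv v.
  rewrite -mem_conjg; apply: RSm; apply/RP.
  by rewrite xy conjgKV.
exists (iota v (y ^ m^-1)); rewrite iota_S //; split=> //.
by rewrite (hP _ Sy).2 (hom_onJ (@ivM v)) ?groupV // xy -!conjgM !mulgA.
Qed.

(** * Generation by the vertex fusion systems *)

Section VertexFusionGenerates.
Variable F : fusion_pred (gT r).
Hypothesis FS : is_fusion_system (Sv r) F.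
Hypothesis Fvertices : contains_vertex_fusion G Sv iota F.

Lemma fusion_ext (P Q : {group gT r}) (phi psi : gT r -> gT r) :
  {in P, phi =1 psi} -> F P Q phi -> F P Q psi.
Proof. by case: FS => H _ _ _ _; apply: H. Qed.

Lemma fusion_comp (P Q R : {group gT r}) (phi psi : gT r -> gT r) :
  F P Q phi -> F Q R psi -> F P R (fun x => psi (phi x)).
Proof. by case: FS => _ _ _ H _; apply: H. Qed.

Lemma fusion_incl (P Q : {group gT r}) :
  P \subset Q -> Q \subset Sv r -> F P Q id.
Proof.
move=> sPQ sQ; have [_ _ H _ _] := FS.
apply: (fusion_ext (phi := fun x => x ^ 1)) => [x _|]; first by rewrite conjg1.
by apply: H; rewrite ?conjsg1 // (subset_trans sPQ).
Qed.

(** The last axiom of a fusion system restricts the target to the image, which is then included in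
    [R]. *)
Lemma fusion_codom (P Q R : {group gT r}) (phi : gT r -> gT r) :
  F P Q phi -> (forall x, x \in P -> phi x \in R) -> R \subset Sv r -> F P R phi.
Proof.
move=> Fphi PR sR; have [_ H2 _ _ H5] := FS.
have [_ _ phiM _ _] := H2 _ _ _ Fphi.
pose I := [group of Morphism phiM @* P].
have eI : I :=: phi @: P by rewrite /= morphimEdom.
have [FI _] := H5 _ _ _ _ Fphi eI.
apply: (fusion_comp (psi := id) FI); apply: fusion_incl => //.
by rewrite eI; apply/subsetP => _ /imsetP[x Px ->]; apply: PR.
Qed.

(** The given morphism, with target cut down to its image, is composed with the generator of F(v)
    induced by [g]. *)
Lemma fusion_vertex (P : {group gT r}) v (psi : gT r -> gT v) g :
  {in P &, {morph psi : x y / x * y}} -> g \in G v ->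
  (forall x, x \in P -> psi x \in Sv v) ->
  (forall x, x \in P -> psi x ^ g \in Sv v) ->
  F P (Sv r) (fun x => iota v (psi x)) ->
  F P (Sv r) (fun x => iota v (psi x ^ g)).
Proof.
move=> psiM Gg Spsi Spsig Fpsi.
pose P0 := [group of Morphism psiM @* P].
have P0E : P0 :=: psi @: P by rewrite /= morphimEdom.
have sP0 : P0 \subset Sv v.
  by rewrite P0E; apply/subsetP => _ /imsetP[x Px ->]; apply: Spsi.
pose P' := [group of Morphism (@iotaM v) @* P0].
have P'E : P' :=: iota v @: P0 by rewrite /= morphimEsub.
pose T' := [group of Morphism (@iotaM v) @* Sv v].
have T'E : T' :=: iota v @: Sv v by rewrite /= morphimEdom.
(* Conjugation by [g] carried over to S through [iota v], with default 1 off the image of S(v). *)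
pose phi z := if [pick y in Sv v | iota v y == z] is Some y then iota v (y ^ g) else 1.
have phiE y : y \in Sv v -> phi (iota v y) = iota v (y ^ g).
  move=> Sy; rewrite /phi; case: pickP => [x /andP[Sx /eqP/iota_inj->] //|].
  by move/(_ y); rewrite Sy eqxx.
have sub_iota (A : {set gT v}) : A \subset Sv v -> iota v @: A \subset Sv r.
  by move=> /subsetP sA; apply/subsetP => _ /imsetP[x /sA/iota_S Sx ->].
have Fphi : F P' T' phi.
  apply: (@Fvertices v P P' T' g phi P0) => //.
    by rewrite P0E; apply/subsetP => _ /imsetP[_ /imsetP[x Px ->] ->]; apply: Spsig.
  by move=> y /(subsetP sP0)/phiE.
have FP' : F P P' (fun x => iota v (psi x)).
  apply: fusion_codom Fpsi _ _; last by rewrite P'E sub_iota.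
  by move=> x Px; rewrite P'E P0E !imset_f.
apply: fusion_codom (fusion_ext _ (fusion_comp FP' Fphi)) _ _ => // x Px.
  by rewrite phiE ?Spsi.
by rewrite iota_S ?Spsig.
Qed.

(* P fixes the vertex u = (v, g), and some conjugation carrying P into S(v), of
   the form x |-> x ^ (g^-1 k) with k in G(v), is a morphism of F after the
   identification of S(v) with a subgroup of S. *)
Definition realized (P : {group gT r}) (u : V * C) : Prop :=
  exists (k : gT u.1) (psi : gT r -> gT u.1), k \in G u.1 /\
    (forall x, x \in P -> psi x \in Sv u.1 /\
       iv u.1 (psi x) = iv r x ^ (u.2^-1 * iv u.1 k)) /\
    F P (Sv r) (fun x => iota u.1 (psi x)).

Lemma conj_morph (P : {group gT r}) v (psi : gT r -> gT v) h :
  P \subset G r ->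
  (forall x, x \in P -> psi x \in G v /\ iv v (psi x) = iv r x ^ h) ->
  {in P &, {morph psi : x y / x * y}}.
Proof.
move=> /subsetP sP psiP x y Px Py; have [Gx ex] := psiP x Px.
have [Gy ey] := psiP y Py; have [Gxy exy] := psiP _ (groupM Px Py).
apply: (@iv_inj v); rewrite ?groupM //.
by rewrite exy ivM ?sP // conjMg -ex -ey ivM.
Qed.

(** A change of representative by y in G(v) is absorbed by replacing [k] with [y * k]. *)
Lemma realized_coset (P : {group gT r}) v g :
  realized P (vtx vgrp v g) <-> realized P (v, g).
Proof.
suff R z w : vgrp v (w * z^-1) -> realized P (v, z) -> realized P (v, w).
  have [_ _ gV] := vgrp_subgroup v; have := repP (vgrp_subgroup v) g.
  by move=> H; split; apply: R => //; move/gV: H; rewrite invgM invgK.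
case/vgrpP=> y Gy ey [k [psi [/= Gk [psiP Fpsi]]]].
exists (y * k), psi; rewrite /= groupM //; split=> //; split=> // x Px.
have [Sx ->] := psiP x Px; split=> //; congr (_ ^ _).
by rewrite ivM // ey -mulgA mulKg.
Qed.

(** Sylow's theorem in the edge group moves the copy of [P] into [S0]. This alters [psi] by an
    element of G(v0), hence by a morphism of F(v0); on [S0] both identifications agree, so the map
    can be read at v1. The two ends are kept abstract so that an edge can be crossed either way. *)
Lemma realized_edge (eT' : finGroupType) (E S0 : {group eT'}) v0 v1
    (f0 : {morphism E >-> gT v0}) (f1 : {morphism E >-> gT v1}) g0 g1
    (P : {group gT r}) h :
  'injm f0 -> (forall y, y \in E -> f0 y \in G v0 /\ f1 y \in G v1) ->
  (forall y, y \in E -> iv v0 (f0 y) = iv v1 (f1 y)) ->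
  p.-Sylow(E) S0 -> g0 \in G v0 -> g1 \in G v1 ->
  (forall y, y \in S0 -> f0 y ^ g0 \in Sv v0 /\ f1 y ^ g1 \in Sv v1) ->
  (forall y, y \in S0 -> iota v0 (f0 y ^ g0) = iota v1 (f1 y ^ g1)) ->
  P \subset Sv r ->
  (forall x, x \in P -> exists2 y, y \in E & iv v0 (f0 y) = h * iv r x * h^-1) ->
  realized P (v0, h) -> realized P (v1, h).
Proof.
move=> inj0 fG ivf sylS Gg0 Gg1 fS iotaf sPS Pfix [k [psi [/= Gk [psiP Fpsi]]]].
have S0E := subsetP (pHall_sub sylS).
have sPG : P \subset G r := subset_trans sPS (pHall_sub (sylSv r)).
(* The element of the edge group representing the conjugate of [x] by [h^-1]. *)
pose th x := odflt 1 [pick y in E | iv v0 (f0 y) == h * iv r x * h^-1].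
have thP x : x \in P -> th x \in E /\ iv v0 (f0 (th x)) = iv r x ^ h^-1.
  move=> Px; have [y Ey ey] := Pfix x Px; rewrite /th conjgE invgK mulgA.
  case: pickP => [z /andP[Ez /eqP ez] //|/(_ y)].
  by rewrite Ey ey eqxx.
have f0thM : {in P &, {morph (fun x => f0 (th x)) : x y / x * y}}.
  apply: (conj_morph (h := h^-1)) => // x /thP[Ex ex].
  by split=> //; have [] := fG _ Ex.
have thM : {in P &, {morph th : x y / x * y}}.
  move=> x y Px Py; have [[Ex _] [Ey _]] := (thP x Px, thP y Py).
  have [Exy _] := thP _ (groupM Px Py).
  by apply: (injmP inj0); rewrite ?groupM // f0thM // morphM.
have pTh : p.-group (Morphism thM @* P).
  exact/morphim_pgroup/(pgroupS sPS)/(pHall_pgroup (sylSv r)).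
have sTh : Morphism thM @* P \subset E.
  by rewrite morphimEdom; apply/subsetP => _ /imsetP[x /thP[? _] ->].
have [m Em /subsetP thS] := Sylow_subJ sylS sTh pTh.
pose n := m^-1; have En : n \in E by rewrite groupV.
have Sth x : x \in P -> th x ^ n \in S0.
  move=> Px; rewrite -mem_conjg; apply: thS.
  exact: (mem_morphim (Morphism thM)).
have psiE x : x \in P -> psi x = f0 (th x) ^ k.
  move=> Px; have [Sx ex] := psiP x Px; have [Ex eth] := thP x Px.
  have [Gx _] := fG _ Ex; apply: (@iv_inj v0); [exact: SvG | exact: groupJ|].
  by rewrite ex (hom_onJ (@ivM v0)) // eth -conjgM.
have [Gn0 Gn1] := fG _ En.
have psiJ x : x \in P -> psi x ^ (k^-1 * (f0 n * g0)) = f0 (th x ^ n) ^ g0.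
  move=> Px; have [Ex _] := thP x Px.
  by rewrite psiE // conjgM conjgK conjgM morphJ.
exists (f1 n * g1), (fun x => f1 (th x ^ n) ^ g1); rewrite /= groupM //.
split=> //; split=> [x Px|].
  have [Ex ex] := thP x Px; have [_ Gx1] := fG _ Ex.
  split; first by have [] := fS _ (Sth x Px).
  rewrite morphJ // -conjgM (hom_onJ (@ivM v1)) ?groupM // -ivf // ex -conjgM.
  by [].
have psiM : {in P &, {morph psi : x y / x * y}}.
  by apply: (conj_morph (h := h^-1 * iv v0 k)) => // x /psiP[/SvG ? ?].
apply: (fusion_ext (phi := fun x => iota v0 (psi x ^ (k^-1 * (f0 n * g0))))).
  by move=> x Px /=; rewrite psiJ // iotaf ?Sth.
apply: fusion_vertex => // [|x /psiP[]//|x Px]; first by rewrite !groupM ?groupV.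
by rewrite psiJ //; have [] := fS _ (Sth x Px).
Qed.

Lemma realized_step (P : {group gT r}) v h : v != r -> P \subset Sv r ->
  (forall x, x \in P -> egrp v (h * iv r x * h^-1)) ->
  realized P (v, h) <-> realized P (par v, h).
Proof.
move=> vr sPS fixP; have [injd inju _ _] := tog.2 v vr.
have [sylS gdG guG sd su] := Se_edge vr; have SG := subsetP (pHall_sub sylS).
split.
  apply: (realized_edge (f0 := fd v) (f1 := fu v) injd _ _ sylS gdG guG) => //.
  - by move=> y Gy; rewrite fdG ?fuG.
  - by move=> y Gy; apply: iv_edge.
  - by move=> y Sy; rewrite sd ?su.
  - by move=> y; apply: ident.2.
  - by move=> x /fixP/(egrpP _ vr).
apply: (realized_edge (f0 := fu v) (f1 := fd v) inju _ _ sylS guG gdG) => //.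
- by move=> y Gy; rewrite fdG ?fuG.
- by move=> y Gy; rewrite iv_edge.
- by move=> y Sy; rewrite sd ?su.
- by move=> y Sy; rewrite ident.2.
- by move=> x /fixP/(egrpP _ vr)[y Gy ey]; exists y; rewrite // -iv_edge.
Qed.

Lemma fusion_of_completion (P Q : {group gT r}) (phi : gT r -> gT r) :
  FC P Q phi -> F P Q phi.
Proof.
case=> sPS sQS [g gP]; have [c [c1 c2 c3]] := path_cocycle.
pose PC z := exists2 x, x \in P & iv r x = z.
have SG := SvG (v := r).
have PG x : x \in P -> x \in G r by move/(subsetP sPS)/SG.
have QG x : x \in P -> phi x \in G r by move/gP => -[/(subsetP sQS)/SG].
(* [P] fixes this translate of the base vertex because conjugation by [g] carries [P] into G(r). *)
have [q0 pq0 lq0] := completion_conn r g^-1.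
case/shortenP: pq0 lq0 => q pq uq _ lq.
have fix_vtx z w : vgrp r (z * w * z^-1) ->
    vact vgrp (vtx vgrp r z) w = vtx vgrp r z.
  move=> Kz; rewrite vact_vtx; last exact: vgrp_subgroup.
  by apply/eqP; rewrite vtx_eq; last exact: vgrp_subgroup.
have : realized P (last (vtx vgrp r 1) q).
  apply: (path_fixed tree vgrp_subgroup egrp_subgroup egrp_vgrp egrp_vgrpp
            c1 c2 c3 (P := PC) _ pq uq).
  - move=> v h vr fixe; rewrite !realized_coset; apply: realized_step => // x Px.
    by apply: fixe; exists x.
  - move=> _ [x Px <-]; apply: fix_vtx; rewrite mul1g invg1 mulg1.
    by apply/vgrpP; exists x; rewrite ?PG.
  - move=> _ [x Px <-]; rewrite lq; apply: fix_vtx; rewrite invgK -mulgA -conjgE.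
    by have [_ <-] := gP x Px; apply/vgrpP; exists (phi x); rewrite ?QG.
  (* At the base vertex the inclusion of [P] in S is a realization. *)
  apply/realized_coset; exists 1, id; rewrite /= group1; split=> //; split=> [x Px|].
    by rewrite (subsetP sPS) // (hom_on1 (@ivM r)) invg1 mulg1 conjg1.
  apply: (fusion_ext (phi := id)) => [x Px|]; last exact: fusion_incl.
  by rewrite iota_root // (subsetP sPS).
rewrite lq => /realized_coset[k [psi [/= Gk [psiP Fpsi]]]].
(* At the far end the realized map is [phi] followed by conjugation by [k] in G(r), which
   [fusion_vertex] undoes below. *)
have psiE x : x \in P -> psi x = phi x ^ k.
  move=> Px; have [Sx ex] := psiP x Px; have [_ ephi] := gP x Px.
  apply: (@iv_inj r); [exact: SG | by rewrite groupJ ?QG|].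
  by rewrite ex invgK conjgM -ephi (hom_onJ (@ivM r)) ?QG.
have Sphi x : x \in P -> phi x \in Sv r by move/gP => -[/(subsetP sQS)].
have psiM : {in P &, {morph psi : x y / x * y}}.
  apply: (conj_morph (h := g^-1^-1 * iv r k)) => [|x /psiP[/SG]//].
  exact/subsetP/PG.
have psiK x : x \in P -> psi x ^ k^-1 = phi x by move=> Px; rewrite psiE // conjgK.
apply: (fusion_codom (Q := Sv r)) => // [|x /gP[]//].
apply: (fusion_ext (phi := fun x => iota r (psi x ^ k^-1))) => [x Px|].
  by rewrite psiK // iota_root ?Sphi.
apply: fusion_vertex => // [|x /psiP[]//|x Px]; first by rewrite groupV.
by rewrite psiK ?Sphi.
Qed.

End VertexFusionGenerates.

End Completion.

Theorem theoremA (p : nat) (V : finType) (r : V) (par : V -> V)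
  (gT eT : V -> finGroupType)
  (G : forall v, {group gT v}) (Ge : forall v, {group eT v})
  (fd : forall v, {morphism Ge v >-> gT v})
  (fu : forall v, {morphism Ge v >-> gT (par v)})
  (C : groupType) (iv : forall v, gT v -> C)
  (Sv : forall v, {group gT v}) (Se : forall v, {group eT v})
  (gd : forall v, gT v) (gu : forall v, gT (par v))
  (iota : forall v, gT v -> gT r) :
  prime p ->
  @tree_of_groups V r par gT eT G Ge fd fu ->
  @is_completion V r par gT eT G Ge fd fu C iv ->
  @induced_tree_of_fusion_systems p V r par gT eT G Ge fd fu Sv Se gd gu ->
  @hypothesis_H V r par gT eT Ge fd Sv Se gd ->
  @identification V r par gT eT Ge fd fu Sv Se gd gu iota ->
  (* (a) S = Sv r is a Sylow p-subgroup of the completion *)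
  (forall P : C -> Prop, finite_p_subgroup p P ->
     exists g : C, forall x, P x ->
       exists y, y \in Sv r /\ iv r y = x ^ g) /\
  (* (b) F_S(G_T) = F_T *)
  (forall (P Q : {group gT r}) (phi : gT r -> gT r),
     @completion_fusion V r gT Sv C iv P Q phi <-> @tree_fusion_completion V r gT G Sv iota P Q phi).
Proof.
move=> p_pr tog compl tofs hypH ident; split=> [P fP|P Q phi].
  exact: (completion_sylow tog compl p_pr tofs hypH ident fP).
split=> [FPQ F FS FV|]; first exact: (fusion_of_completion tog compl tofs hypH ident FS FV FPQ).
apply.
  exact: (completion_fusion_system tog compl tofs).
exact: (completion_fusion_vertices tog compl tofs hypH ident).
Qed.
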